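(* Let $\mathscr{L}$ be a bounded distributive lattice, let $S \subseteq \mathscr{L}$ be $\vee$-closed, and let $\mathfrak{p}$ be a filter of $\mathscr{L}$ such that $\mathfrak{p} \cap S = \varnothing$. Put $\mathfrak{p}_S = \{a \in \mathscr{L} \mid a \vee t \in \mathfrak{p} \text{ for some } t \in S\}$. Then $\mathfrak{p}_S$ is the smallest (with respect to inclusion) $S$-filter of $\mathscr{L}$ containing $\mathfrak{p}$.
   Context: A bounded lattice has a least element $0$ and a greatest element $1$. A filter of $\mathscr{L}$ is a non-empty subset $F \subseteq \mathscr{L}$ such that $u \wedge v \in F$ for all $u,v \in F$, and $u \in F$, $w \in \mathscr{L}$, $u \le w$ imply $w \in F$; it is proper if $F \ne \mathscr{L}$. A subset $S \subseteq \mathscr{L}$ is $\vee$-closed if $0 \in S$ and $s_1 \vee s_2 \in S$ for all $s_1,s_2 \in S$. For a $\vee$-closed $S$, a proper filter $\mathfrak{q}$ of $\mathscr{L}$ is an $S$-filter if for all $u,v \in \mathscr{L}$, $u \vee v \in \mathfrak{q}$ and $u \in S$ imply $v \in \mathfrak{q}$. *)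

(* Defs.v *)
From mathcomp Require Import all_boot all_order.
From mathcomp Require Import classical_sets.

Set Implicit Arguments.
Unset Strict Implicit.
Unset Printing Implicit Defensive.

Local Open Scope classical_set_scope.

Definition lattice_filter (d : Order.disp_t) (L : tbDistrLatticeType d)
    (F : set L) : Prop :=
  [/\ F !=set0,
      (forall u v : L, F u -> F v -> F (u `&` v)%O)
    & (forall u w : L, F u -> (u <= w)%O -> F w)].

Definition proper_lattice_filter (d : Order.disp_t) (L : tbDistrLatticeType d)
    (F : set L) : Prop :=
  lattice_filter F /\ F <> [set: L].

Definition join_closed (d : Order.disp_t) (L : tbDistrLatticeType d)
    (S : set L) : Prop :=
  S \bot%O /\ (forall s1 s2 : L, S s1 -> S s2 -> S (s1 `|` s2)%O).

Definition S_filter (d : Order.disp_t) (L : tbDistrLatticeType d)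
    (S q : set L) : Prop :=
  proper_lattice_filter q /\
  (forall u v : L, q (u `|` v)%O -> S u -> q v).

Definition filter_S (d : Order.disp_t) (L : tbDistrLatticeType d)
    (p S : set L) : set L :=
  [set a | exists2 t, S t & p (a `|` t)%O].

(* Main.v *)
Require Import Defs.
From mathcomp Require Import all_boot all_order.
From mathcomp Require Import classical_sets.

(** An element [a] enters [filter_S p S] when some denominator [t] of [S]
    satisfies [a `|` t \in p], so this set is a lattice analogue of the
    contraction of a localized ideal.  Distributivity makes it closed under
    meets: two elements can be brought to the common denominator [t1 `|` t2],
    and joining with a fixed element commutes with meets
    ([lattice_filter_filter_S]).  Since an element of [S] can be absorbed into
    the denominator, cancelling it stays inside the set.  Properness amounts to
    the disjointness of [p] and [S], because the denominators of [\bot] are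
    exactly the elements of [S] lying in [p] ([filter_S_bot]).  The denominator
    [\bot] gives the inclusion of [p], and minimality holds because an
    [S]-filter containing [a `|` t] must contain [a] by its very definition. *)

Import Order.LTheory.
(* [Order.LTheory] has its own [join_closed], for boolean predicates; the second
   import makes the name denote the property of sets again. *)
Import Defs.

Local Open Scope classical_set_scope.

(** As an up-closed set is everything once it contains [\bot], this turns
    properness of [filter_S p S] into disjointness of [p] and [S]. *)
Lemma filter_S_bot (d : Order.disp_t) (L : tbDistrLatticeType d)
    (S p : set L) : filter_S p S \bot%O <-> p `&` S !=set0.
Proof.
split=> [[t St]|[t [pt St]]]; first by rewrite join0x => pt; exists t.
by exists t; rewrite ?join0x.
Qed.

Lemma sub_filter_S (d : Order.disp_t) (L : tbDistrLatticeType d)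
    (S p : set L) : S \bot%O -> p `<=` filter_S p S.
Proof. by move=> S0 a pa; exists \bot%O; rewrite ?joinx0. Qed.

(** Distributivity is what makes meets work: joining with a common denominator
    turns a meet of numerators into a meet of two elements of [p]. *)
Lemma lattice_filter_filter_S (d : Order.disp_t) (L : tbDistrLatticeType d)
    (S p : set L) :
  join_closed S -> lattice_filter p -> lattice_filter (filter_S p S).
Proof.
move=> [S0 SU] [[x px] pI pW]; split.
- by exists x; apply: sub_filter_S.
- move=> u v [t1 St1 pu] [t2 St2 pv].
  exists (t1 `|` t2)%O; first exact: SU.
  rewrite joinIl; apply: pI.
  + by apply: pW pu _; rewrite joinA leUl.
  + by apply: pW pv _; rewrite joinCA leUr.
- move=> u w [t St pu] le_uw; exists t => //.
  by apply: pW pu _; apply: leU2.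
Qed.

Theorem theorem3p6 (d : Order.disp_t) (L : tbDistrLatticeType d)
    (S p : set L) (hS : join_closed S) (hp : lattice_filter p)
    (hpS : p `&` S = set0) :
  [/\ S_filter S (filter_S p S),
      p `<=` filter_S p S
    & forall q : set L, S_filter S q -> p `<=` q -> filter_S p S `<=` q].
Proof.
have [S0 SU] := hS; split; last 1 first.
- move=> q [_ qS] pq a [t St pa].
  by apply: (qS t) => //; rewrite joinC; apply: pq.
- split; first split.
  + exact: lattice_filter_filter_S.
  + move=> pST; have : filter_S p S \bot%O by rewrite pST.
    by move=> /filter_S_bot; rewrite hpS => -[].
  + (* The cancelled element [u] joins the denominator. *)
    move=> u v [t St puv] Su; exists (u `|` t)%O; first exact: SU.
    by rewrite joinCA joinA.
- exact: sub_filter_S.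
Qed.
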